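(* Let $N$ be a normal subgroup of a finite group $G$. Let $A$ be a group which acts on the set $\mathrm{Min}_G(N)$ of minimal $G$-invariant characters of $N$ and on the set of $G$-conjugacy classes of $N$. Assume that $\widehat{\theta}^{\,a}(n^a)=\widehat{\theta}(n)$ for all $\widehat{\theta}\in\mathrm{Min}_G(N)$, $a\in A$ and $n\in N$, where $n^a$ is an element of $(n^G)^a$. Then for each $a\in A$, the number of characters of $\mathrm{Min}_G(N)$ fixed by $a$ is equal to the number of $G$-conjugacy classes of $N$ fixed by $a$.
   Context: All groups are finite; characters are over $\mathbb{C}$. The $G$-conjugacy classes of $N$ are the conjugacy classes $n^G$ of $G$ with $n\in N$. $G$ acts on $\mathrm{Irr}(N)$ by $\theta^g(x)=\theta(gxg^{-1})$; for $\theta\in\mathrm{Irr}(N)$, $\widehat{\theta}$ is the sum of the distinct $G$-conjugates of $\theta$, and $\mathrm{Min}_G(N)=\{\widehat{\theta}\mid\theta\in\mathrm{Irr}(N)\}$. Elements of $\mathrm{Min}_G(N)$ are constant on $G$-conjugacy classes of $N$, so the value $\widehat{\theta}^{\,a}(n^a)$ does not depend on the choice of $n^a$ in $(n^G)^a$. The notations $\widehat{\theta}^{\,a}$ and $(n^G)^a$ denote the images under the given actions of $a$. *)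

(* Defs.v *)
From HB Require Import structures.
From mathcomp Require Import all_boot all_order all_algebra all_fingroup all_solvable all_field all_character.

Set Implicit Arguments.
Unset Strict Implicit.
Unset Printing Implicit Defensive.

Import GroupScope GRing.Theory.
Local Open Scope ring_scope.

Section MinimalInvariantCharacters.

Variables (gT : finGroupType) (G N : {group gT}).

(* cfclass lists each conjugate exactly once when N <| G (cfclass_uniq), and
   ('chi_i ^ g)%CF x = 'chi_i (g * x * g^-1) for x in N, g in G. *)
Definition orbit_sum (i : Iirr N) : 'CF(N) :=
  \sum_(xi <- ('chi_i ^: G)%CF) xi.

Definition MinG : seq 'CF(N) := undup [seq orbit_sum i | i : Iirr N].

Definition Gclasses : {set {set gT}} := [set n ^: G | n in N].

(* The two sets as finite types, so that A can act on exactly these sets. *)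
Definition MinG_type : finType := seq_sub MinG.

Definition Gclasses_type : finType := {K : {set gT} | K \in Gclasses}.

End MinimalInvariantCharacters.

(* Main.v *)
(** Distinct orbit sums are orthogonal and span the G-invariant class functions
    on N. Hence the "character table" of Min_G(N) against the G-classes of N
    satisfies both orthogonality relations, as in Brauer's permutation lemma:
    the number of fixed characters is the sum over chi of
    '[chi^a, chi] / '[chi]; writing the inner product as a sum over the classes
    K^a, replacing chi^a(k^a) by chi(k) and exchanging the sums, the column
    relation leaves the number of classes K with K^a = K. *)
Require Import Defs.
From HB Require Import structures.
From mathcomp Require Import all_boot all_order all_algebra all_fingroup all_solvable all_field all_character.

Set Implicit Arguments.
Unset Strict Implicit.
Unset Printing Implicit Defensive.

Import GroupScope GRing.Theory.
Local Open Scope ring_scope.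

Section OrbitSums.

Import Num.Theory.

Variables (gT : finGroupType) (G N : {group gT}).
Hypothesis nNG : N <| G.

Lemma irr_cfclass (i : Iirr N) psi :
  psi \in ('chi_i ^: G)%CF -> exists k, psi = 'chi_k.
Proof. by case/cfclassP=> y _ ->; exists (conjg_Iirr i y); rewrite conjg_IirrE. Qed.

Lemma cfdot_orbit_sum_irr (i j : Iirr N) :
  '[orbit_sum G j, 'chi_i] = ('chi_i \in ('chi_j ^: G)%CF)%:R.
Proof.
rewrite /orbit_sum reindex_cfclass // cfdot_suml big_mkcond (bigD1 i) //=.
rewrite cfnorm_irr big1 ?addr0 => [|k neq_ki]; first by case: ifP.
by rewrite cfdot_irr (negPf neq_ki) if_same.
Qed.

(** An orbit sum determines its orbit, because its irreducible constituents are exactly the members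
    of the orbit. *)
Lemma orbit_sum_eq (i j : Iirr N) :
  (orbit_sum G i == orbit_sum G j) = ('chi_i \in ('chi_j ^: G)%CF).
Proof.
apply/eqP/idP=> [eq_ij | /cfclass_transr eq_ij].
  have /eqP: '[orbit_sum G i, 'chi_i] = '[orbit_sum G j, 'chi_i] by rewrite eq_ij.
  by rewrite !cfdot_orbit_sum_irr cfclass_refl eq_sym pnatr_eq1 eqb1.
by apply: perm_big; apply: uniq_perm => [||psi]; rewrite ?cfclass_uniq ?eq_ij.
Qed.

Lemma cfdot_orbit_sumr (phi : 'CF(N)) (j : Iirr N) :
    {in ('chi_j ^: G)%CF, forall psi, '[phi, psi] = '[phi, 'chi_j]} ->
  '[phi, orbit_sum G j] = '[phi, 'chi_j] *+ size ('chi_j ^: G)%CF.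
Proof.
move=> phi_inv; rewrite /orbit_sum cfdot_sumr big_seq.
by rewrite (eq_bigr _ phi_inv) -big_seq big_const_seq count_predT iter_addr_0.
Qed.

(** Each constituent occurs once, so the norm is the orbit length rather than 1; hence the divisions
    by ['[val chi]] later on. *)
Lemma cfdot_orbit_sum (i j : Iirr N) :
  '[orbit_sum G i, orbit_sum G j]
    = (orbit_sum G i == orbit_sum G j)%:R * (size ('chi_j ^: G)%CF)%:R.
Proof.
rewrite cfdot_orbit_sumr => [|psi psi_j].
  by rewrite cfdot_orbit_sum_irr mulr_natr eq_sym orbit_sum_eq.
have [k def_psi] := irr_cfclass psi_j; move: psi_j.
rewrite def_psi !cfdot_orbit_sum_irr -!orbit_sum_eq => /eqP.
by move->.
Qed.

Lemma size_cfclass_neq0 (i : Iirr N) : (size ('chi_i ^: G)%CF)%:R != 0 :> algC.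
Proof.
rewrite pnatr_eq0 size_eq0; apply/eqP=> G0.
by have:= cfclass_refl G 'chi_i; rewrite G0.
Qed.

Lemma cfConjg_orbit_sum (j : Iirr N) y :
  y \in G -> (orbit_sum G j ^ y)%CF = orbit_sum G j.
Proof.
move=> Gy; rewrite [LHS]cfun_sum_cfdot [RHS]cfun_sum_cfdot.
apply: eq_bigr => i _; congr (_ *: _).
(* Writing ['chi_i] as a conjugate by [y] lets the isometry remove [y] from both sides of the inner
   product; what remains is that ['chi_k] and its conjugate lie in the same orbits. *)
rewrite -[i](conjg_IirrKV y) conjg_IirrE cfConjg_iso -conjg_IirrE.
rewrite !cfdot_orbit_sum_irr !['chi__ \in ('chi_j ^: G)%CF]cfclass_sym.
set k := conjg_Iirr i y^-1.
have /cfclass_transr-> //: 'chi_(conjg_Iirr k y) \in ('chi_k ^: G)%CF.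
by apply/cfclassP; exists y; rewrite ?conjg_IirrE.
Qed.

Lemma MinG_typeP (chi : MinG_type G N) : exists j, val chi = orbit_sum G j.
Proof.
by have := valP chi; rewrite mem_undup => /mapP[j _ ->]; exists j.
Qed.

Lemma MinG_cfunJ (chi : MinG_type G N) x y :
  y \in G -> val chi (x ^ y)%g = val chi x.
Proof.
move=> Gy; have [j ->] := MinG_typeP chi.
by rewrite -{1}(cfConjg_orbit_sum j Gy) cfConjgEJ ?(subsetP (normal_norm nNG)).
Qed.

Lemma MinG_cfnorm_neq0 (chi : MinG_type G N) : '[val chi] != 0.
Proof.
have [j ->] := MinG_typeP chi.
by rewrite cfdot_orbit_sum eqxx mul1r size_cfclass_neq0.
Qed.

Lemma MinG_cfdot_eq (chi psi : MinG_type G N) :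
  '[val chi, val psi] / '[val psi] = (chi == psi)%:R.
Proof.
have := MinG_cfnorm_neq0 psi; rewrite -(inj_eq val_inj).
have [[i ->] [j ->]] := (MinG_typeP chi, MinG_typeP psi).
rewrite !cfdot_orbit_sum eqxx mul1r => nz.
by rewrite mulfK.
Qed.

Lemma orbit_sum_MinG (i : Iirr N) : orbit_sum G i \in MinG G N.
Proof. by rewrite mem_undup image_f. Qed.

(** An invariant [phi] has equal coefficients along each orbit, so its irreducible expansion groups
    into orbit sums. The orbit length occurs in both inner products and cancels. *)
Lemma cfun_sum_MinG (phi : 'CF(N)) :
    {in G, forall y, (phi ^ y)%CF = phi} ->
  phi = \sum_(chi : MinG_type G N)
           ('[phi, val chi] / '[val chi]) *: val chi.
Proof.
move=> phiJ; rewrite {1}[phi]cfun_sum_cfdot.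
(* The fibres of [h] are the [G]-orbits on the irreducible characters. *)
pose h i : MinG_type G N := SeqSub (orbit_sum_MinG i).
rewrite (partition_big h xpredT) //=; apply: eq_bigr => chi _.
have [j def_chi] := MinG_typeP chi.
have phi_j: {in ('chi_j ^: G)%CF, forall psi, '[phi, psi] = '[phi, 'chi_j]}.
  by move=> _ /cfclassP[y Gy ->]; rewrite -{1}(phiJ y Gy) cfConjg_iso.
rewrite def_chi cfdot_orbit_sumr // cfdot_orbit_sum eqxx mul1r -mulr_natr.
rewrite mulfK ?size_cfclass_neq0 // /orbit_sum reindex_cfclass // scaler_sumr.
apply: eq_big => [i | i /eqP def_i]; first by rewrite -val_eqE /= def_chi orbit_sum_eq.
congr (_ *: _); apply: phi_j; rewrite -orbit_sum_eq -def_chi -def_i.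
by rewrite eqxx.
Qed.

(* The indicator function of x ^: G is G-invariant: expand it in orbit sums and
   evaluate at y. *)
Lemma MinG_orthogonality x y : x \in N -> y \in N ->
  #|x ^: G|%:R / #|N|%:R
      * \sum_(chi : MinG_type G N) val chi y * (val chi x)^* / '[val chi]
    = (y \in x ^: G)%:R.
Proof.
move=> Nx Ny.
have sxN: x ^: G \subset N by rewrite class_sub_norm ?normal_norm.
have nsxN: x ^: G <| N.
  by rewrite /normal sxN (subset_trans (normal_sub nNG)) ?class_norm.
have xGJ: {in G, forall z, ('1_(x ^: G)%g ^ z)%CF = '1_(x ^: G)%g :> 'CF(N)}.
  by move=> z Gz; rewrite cfConjg_cfuni // (subsetP (class_norm x G)).
have := congr1 (fun phi : 'CF(N) => phi y) (cfun_sum_MinG xGJ).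
rewrite cfuniE // sum_cfunE mulr_sumr => ->.
apply: eq_bigr => chi _; rewrite cfunE.
(* The indicator restricts the sum to [x ^: G], where [chi] is constant. *)
have ->: '['1_(x ^: G), val chi] = #|x ^: G|%:R / #|N|%:R * (val chi x)^*.
  rewrite (cfdotEl _ (cfuni_on N _)) mulrC mulrAC; congr (_ / _).
  rewrite mulr_natl -sumr_const.
  apply: eq_bigr => _ /imsetP[z Gz ->].
  by rewrite cfuniE // memJ_class // mul1r MinG_cfunJ.
by rewrite [RHS]mulrC -!mulrA [RHS]mulrCA [in RHS](mulrCA (val chi y)).
Qed.

Lemma Gclasses_typeP (K : Gclasses_type G N) :
  repr (val K) \in N /\ val K = repr (val K) ^: G.
Proof.
have /imsetP[x Nx ->] := valP K; have [y Gy ->] := repr_class G x.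
by rewrite memJ_norm ?(subsetP (normal_norm nNG)) // classGidl.
Qed.

Lemma MinG_cfun_Gclass (chi : MinG_type G N) (K : Gclasses_type G N) x :
  x \in val K -> val chi x = val chi (repr (val K)).
Proof.
have [_ ->] := Gclasses_typeP K => /imsetP[y Gy ->].
have [z Gz ->] := repr_class G (repr (val K)).
by rewrite !MinG_cfunJ.
Qed.

Lemma MinG_cfdot_Gclasses (chi psi : MinG_type G N) :
  '[val chi, val psi] = \sum_(K : Gclasses_type G N)
    #|val K|%:R / #|N|%:R * (val chi (repr (val K)) * (val psi (repr (val K)))^*).
Proof.
rewrite cfdotE (partition_big_imset (class^~ G)) big_sub mulr_sumr.
apply: eq_bigr => K _; rewrite mulrAC [LHS]mulrC; congr (_ * _).
rewrite mulr_natl -sumr_const; apply: eq_big => [x | x].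
  have [NK defK] := Gclasses_typeP K; rewrite defK.
  apply/andP/idP=> [[_ /eqP <-] | xK]; first exact: class_refl.
  split; last exact/eqP/class_eqP.
  by case/imsetP: xK => y Gy ->; rewrite memJ_norm ?(subsetP (normal_norm nNG)).
case/andP=> Nx /eqP xK; have Kx: x \in val K by rewrite -xK class_refl.
by rewrite !(MinG_cfun_Gclass _ Kx).
Qed.

End OrbitSums.

Theorem theorem5p3 (gT aT : finGroupType) (G N : {group gT}) (A : {group aT})
    (nNG : N <| G)
    (toM : action A (MinG_type G N)) (toK : action A (Gclasses_type G N))
    (compat : forall (chi : MinG_type G N) (a : aT) (n m : gT)
                     (K : Gclasses_type G N),
        a \in A -> n \in N -> val K = n ^: G -> m \in val (toK K a) ->
        (val (toM chi a)) m = (val chi) n)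
    (a : aT) (aA : a \in A) :
  #|'Fix_toM[a]| = #|'Fix_toK[a]|.
Proof.
pose r (K : Gclasses_type G N) := repr (val K).
have rN K: r K \in N by case: (Gclasses_typeP nNG K).
have rG K: val K = r K ^: G by case: (Gclasses_typeP nNG K).
have rK K: r K \in val K by rewrite rG class_refl.
(* Fixed points are counted in [algC], where both counts become sums of character values. *)
have card_fix (T : finType) (to : action A T) :
    #|'Fix_to[a]|%:R = \sum_x (to x a == x)%:R :> algC.
  rewrite -sum1_card natr_sum big_mkcond; apply: eq_bigr => x _.
  by rewrite -(sameP afix1P eqP); case: ifP.
apply/eqP; rewrite -(Num.Theory.eqr_nat algC) !card_fix; apply/eqP.
(* The contribution of the class [toK K a] to ['[chi^a, chi] / '[chi]], with the value of [chi^a]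
   there already replaced by that of [chi] on [K]. *)
pose F (chi : MinG_type G N) (K : Gclasses_type G N) : algC :=
  #|val (toK K a)|%:R / #|N|%:R
    * (val chi (r K) * (val chi (r (toK K a)))^* / '[val chi]).
transitivity (\sum_(chi : MinG_type G N) \sum_K F chi K).
  apply: eq_bigr => chi _; rewrite -MinG_cfdot_eq // MinG_cfdot_Gclasses //.
  (* Since [a] permutes the classes, the sum may run over the images [toK K a], the form in which
     [compat] applies. *)
  rewrite (reindex_inj (act_inj toK a)) mulr_suml; apply: eq_bigr => K _ /=.
  by rewrite -mulrA (compat _ a (r K) _ K) //; apply: rK.
rewrite exchange_big; apply: eq_bigr => K _ /=.
(* Column orthogonality at the representatives of [toK K a] and [K] tests whether [r K] lies in
   [toK K a], that is, whether the two classes coincide. *)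
rewrite -mulr_sumr [val (toK K a)]rG MinG_orthogonality // -rG.
congr (nat_of_bool _)%:R; rewrite -val_eqE; apply/idP/eqP=> [|-> //].
by rewrite [val (toK K a)]rG => /class_eqP <-; rewrite -rG.
Qed.
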